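(* Let $G$ and $G^{*}$ be graphs with standard walk matrices $W$ and $W^{*}$, respectively, and let $n$ be the number of vertices of $G$. Suppose that $W$ has rank $\geq n-1$. Then $G$ is isomorphic to $G^{*}$ if and only if ${\rm lex}(W)={\rm lex}(W^{*})$.
   Context: Graphs are finite, simple and undirected. For a graph with vertex set $V=\{v_1,\dots,v_n\}$ and adjacency matrix $A$, the standard walk matrix is the $n\times n$ matrix $W=[{\rm e},A{\rm e},A^2{\rm e},\dots,A^{n-1}{\rm e}]$ whose columns are $A^k{\rm e}$, where ${\rm e}=(1,\dots,1)^{\tt T}$ is the all-ones vector; its row indexed by $v_\ell$ lists the numbers of walks of lengths $0,\dots,n-1$ starting at $v_\ell$. For a matrix $W$, ${\rm lex}(W)$ denotes the matrix obtained from $W$ by permuting its rows so that they appear in lexicographical order. *)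

(* Defs.v *)
From HB Require Import structures.
From mathcomp Require Import all_boot all_order all_algebra.
Set Implicit Arguments.
Unset Strict Implicit.
Unset Printing Implicit Defensive.
Import Order.TTheory GRing.Theory Num.Theory.
Local Open Scope ring_scope.

Record sgraph := SGraph {
  vertex :> finType;
  edge : rel vertex;
  edge_sym : symmetric edge;
  edge_irrefl : irreflexive edge
}.

Definition isomorphic (G H : sgraph) : Prop :=
  exists2 f : G -> H, bijective f & forall x y : G, edge (f x) (f y) = edge x y.

(* The vertices are numbered by [enum_val]; coefficients are taken in [rat]
   so that [\rank] applies. *)
Definition adjmx (G : sgraph) : 'M[rat]_#|G| :=
  \matrix_(i, j) (edge (enum_val i) (enum_val j))%:R.

Definition walkmx (G : sgraph) : 'M[rat]_#|G| :=
  \matrix_(i, k) ((adjmx G) ^+ k *m (const_mx 1 : 'cV[rat]_#|G|)) i 0.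

Definition lex (m n : nat) (A : 'M[rat]_(m, n)) : 'M[rat]_(m, n) :=
  let rows : m.-tuple (n.-tuplelexi rat) := [tuple [tuple A i j | j < n] | i < m] in
  \matrix_(i, j) tnth (tnth (sort_tuple <=%O rows) i) j.

(* Equality of matrices whose sizes are not known in advance to agree. *)
Definition eqmatrix (m n m' n' : nat) (A : 'M[rat]_(m, n)) (B : 'M[rat]_(m', n')) :
    Prop :=
  exists eq_mn : (m = m') * (n = n'), castmx eq_mn A = B.

(* Main.v *)
Require Import Defs.
From mathcomp Require Import all_boot all_order all_algebra all_fingroup.
Set Implicit Arguments.
Unset Strict Implicit.
Unset Printing Implicit Defensive.
Import Order.TTheory GRing.Theory Num.Theory.
Local Open Scope ring_scope.

(** Equality of the sorted walk matrices means that the rows of [W] and [W*]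
agree up to a permutation; after relabelling, [W = W*].  Then the symmetric
matrix [D = A - A*] kills [A^k e] for all [k < n - 1], so that [D W] vanishes
outside its last column.  If [W] is invertible, then [D] has rank at most 1.
If not, a linear relation between the columns of [W], shifted by a power of
[A], expresses [A^(n-1) e] by lower powers, so [D W = 0] and again
[D] has rank at most 1, because [W] has rank at least [n - 1].  Finally,
[D] is symmetric with zero diagonal and of rank at most 1, hence zero. *)

(** Rank at most 1 makes the 2x2 minors vanish, so [D i j * D j i = D i i * D j j]: the left side is
    the square of [D i j], the right side is 0. *)
Lemma sym_hollow_rank1_eq0 (F : fieldType) (n : nat) (D : 'M[F]_n) :
  D^T = D -> (forall i, D i i = 0) -> (\rank D <= 1)%N -> D = 0.
Proof.
move=> symD diagD rankD; apply/matrixP=> i j; rewrite mxE.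
suff minorD : D i j * D j i = D i i * D j j.
  have /eqP := minorD; rewrite -[in D j i]symD mxE diagD mul0r mulf_eq0 orbb.
  by move/eqP.
have [D0 | D1] : \rank D = 0%N \/ \rank D = 1%N.
- by move: rankD; case: (\rank D) => [|[|]] //; [left | right].
- by move/eqP: D0; rewrite mxrank_eq0 => /eqP->; rewrite !mxE !mulr0.
have [u [v ->]] : exists (u : 'cV_n) (v : 'rV_n), D = u *m v.
  move: (col_base D) (row_base D) (mulmx_base D); rewrite D1 => u v <-.
  by exists u, v.
by rewrite !mxE !big_ord1 mulrACA [v 0 j * _]mulrC mulrACA.
Qed.

Lemma mulmx_expD (n p j k : nat) (A : 'M[rat]_n) (v : 'M[rat]_(n, p)) :
  A ^+ (j + k) *m v = A ^+ j *m (A ^+ k *m v).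
Proof. by rewrite exprD -mulmxA. Qed.

Definition ones (n : nat) : 'cV[rat]_n := const_mx 1.

(** Stated for any matrix so that relabelled adjacency matrices are covered; [walkmx G] is
    convertible to [krylov (adjmx G)]. *)
Definition krylov (n : nat) (A : 'M[rat]_n) : 'M[rat]_n :=
  \matrix_(i, k) (A ^+ k *m ones n) i 0.

Lemma col_krylov (n : nat) (A : 'M[rat]_n) (k : 'I_n) :
  col k (krylov A) = A ^+ k *m ones n.
Proof. by apply/matrixP=> i j; rewrite !mxE ord1. Qed.

Lemma krylov_inj (n : nat) (A B : 'M[rat]_n) :
    A^T = A -> B^T = B -> (forall i, A i i = 0) -> (forall i, B i i = 0) ->
    (n.-1 <= \rank (krylov A))%N -> krylov A = krylov B ->
  A = B.
Proof.
case: n A B => [|n] A B symA symB diagA diagB rankA eqK.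
  by apply/matrixP=> -[].
have eqpow (k : nat) : (k <= n)%N -> A ^+ k *m ones n.+1 = B ^+ k *m ones n.+1.
  move=> lekn; have := col_krylov A (inord k); rewrite eqK col_krylov.
  by rewrite inordK ?ltnS.
pose D := A - B.
(* [A A^k e = A^(k+1) e = B^(k+1) e = B A^k e]. The size is [n.+1], so the powers are known to agree
   only up to [n], whence [k < n]. *)
have kill (k : nat) : (k < n)%N -> D *m (A ^+ k *m ones n.+1) = 0.
  move=> ltkn; rewrite /D mulmxBl {2}(eqpow k (ltnW ltkn)) -!(mulmx_expD 1).
  by rewrite !add1n (eqpow k.+1) // subrr.
have killW (k : 'I_n.+1) : (k < n)%N -> col k (D *m krylov A) = 0.
  by move=> ltkn; rewrite colE -mulmxA -colE col_krylov kill.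
suff D0 : D = 0 by apply/eqP; rewrite -subr_eq0; apply/eqP.
apply: sym_hollow_rank1_eq0.
- by rewrite /D linearB /= symA symB.
- by move=> i; rewrite !mxE diagA diagB subrr.
have [unitK | nunitK] := boolP (krylov A \in unitmx).
  have -> : \rank D = \rank (D *m krylov A).
    by rewrite mxrankMfree // row_free_unit.
  (* Only the last column survives, so the product is a column times a row. *)
  have -> : D *m krylov A = col ord_max (D *m krylov A) *m delta_mx 0 ord_max.
    apply/matrixP=> i j; rewrite [RHS]mxE big_ord1 [X in _ = X * _]mxE.
    rewrite [delta_mx _ _ _ _]mxE eqxx /=.
    have [-> | nj] := eqVneq j ord_max; first by rewrite mulr1.
    have /colP/(_ i) : col j (D *m krylov A) = 0.
      by apply: killW; rewrite ltn_neqAle -ltnS ltn_ord andbT; exact: nj.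
    by rewrite mxE => ->; rewrite mxE mulr0.
  by apply: leq_trans (mxrankM_maxl _ _) _; rewrite rank_leq_col.
have [c cn0 Kc0] : exists2 c : 'cV[rat]_n.+1, c != 0 & krylov A *m c = 0.
  have : ~~ row_free (krylov A)^T by rewrite row_free_unit unitmx_tr.
  rewrite -kermx_eq0 => /rowV0Pn[v /sub_kermxP vK vn0].
  exists v^T; first by rewrite -trmx0 (inj_eq trmx_inj).
  by apply: trmx_inj; rewrite trmx_mul trmxK vK trmx0.
(* [m] is the degree of the relation [c]: the shift by [A ^+ (n - m)] lifts its top term exactly to
   [A ^+ n] and keeps the others below. *)
have [m cm0 maxm] : exists2 m : 'I_n.+1, c m 0 != 0 &
    forall k : 'I_n.+1, c k 0 != 0 -> (k <= m)%N.
  have /cV0Pn[i0 ci0] := cn0.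
  pose P := [pred i | c i 0 != 0]; have Pi0 : P i0 by [].
  by case: (arg_maxnP (fun i : 'I_n.+1 => i : nat) Pi0) => m; exists m.
have lemn : (m <= n)%N by rewrite -ltnS.
have last0 : D *m (A ^+ n *m ones n.+1) = 0.
  have Kc : krylov A *m c = \sum_k c k 0 *: (A ^+ k *m ones n.+1).
    apply/colP=> i; rewrite mxE summxE; apply: eq_bigr => k _.
    by rewrite !mxE mulrC.
  (* After the shift by [A ^+ (n - m)], [D] kills every term but the [m]-th. *)
  have : D *m (A ^+ (n - m) *m (krylov A *m c)) = 0 by rewrite Kc0 !mulmx0.
  rewrite Kc !mulmx_sumr (bigD1 m) //= big1 ?addr0 => [|k nkm].
    rewrite -!scalemxAr -mulmx_expD subnK //.
    by move/eqP; rewrite scaler_eq0 (negPf cm0) => /eqP.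
  have [-> | ck0] := eqVneq (c k 0) 0; first by rewrite scale0r !mulmx0.
  rewrite -!scalemxAr -mulmx_expD kill ?scaler0 //.
  have ltkm : (k < m)%N by rewrite ltn_neqAle maxm // andbT; exact: nkm.
  by rewrite -[X in (_ < X)%N](subnK lemn) ltn_add2l.
have DK0 : D *m krylov A = 0.
  apply/matrixP=> i k; suff /colP/(_ i) : col k (D *m krylov A) = 0.
    by rewrite mxE => ->; rewrite !mxE.
  have [ltkn | lenk] := ltnP k n; first exact: killW.
  have ek : k = n :> nat by apply/eqP; rewrite eqn_leq lenk -ltnS ltn_ord.
  by rewrite colE -mulmxA -colE col_krylov ek.
(* [D *m krylov A = 0] bounds the sum of the two ranks by [n.+1], and [krylov A] has rank at least
   [n]. *)
rewrite -(leq_add2r n) add1n.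
exact: leq_trans (leq_add (leqnn _) rankA) (mulmx0_rank_max DK0).
Qed.

(** The lexicographic order is total, so the sorted list of rows is a canonical form of their
    multiset. *)
Lemma lex_eqP (m n : nat) (A B : 'M[rat]_(m, n)) :
  lex A = lex B <-> exists s : 'S_m, row_perm s A = B.
Proof.
pose rows (M : 'M[rat]_(m, n)) : m.-tuple (n.-tuplelexi rat) :=
  [tuple [tuple M i j | j < n] | i < m].
have rowsE M i j : tnth (tnth (rows M) i) j = M i j by rewrite !tnth_mktuple.
have sortE : lex A = lex B <-> sort <=%O (rows A) = sort <=%O (rows B).
  split=> [eqL | eqS].
    have : sort_tuple <=%O (rows A) = sort_tuple <=%O (rows B).
      apply: eq_from_tnth => i; apply: eq_from_tnth => j.
      by have /matrixP/(_ i j) := eqL; rewrite !mxE.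
    by move/(congr1 val).
  have eqT : sort_tuple <=%O (rows A) = sort_tuple <=%O (rows B) by apply: val_inj.
  by apply/matrixP=> i j; rewrite !mxE -/(rows A) -/(rows B) eqT.
apply: iff_trans sortE _; split.
  move/(perm_sortP le_total le_trans le_anti); rewrite perm_sym.
  case/tuple_permP=> s eqs; exists s; apply/matrixP=> i j; rewrite mxE -!rowsE.
  suff -> : rows B = [tuple tnth (rows A) (s i) | i < m] by rewrite tnth_mktuple.
  exact: val_inj.
case=> s <-; apply/(perm_sortP le_total le_trans le_anti); rewrite perm_sym.
apply/tuple_permP; exists s; congr val; apply: eq_from_tnth => i.
by apply: eq_from_tnth => j; rewrite rowsE tnth_mktuple rowsE mxE.
Qed.

(** Permutations fix the all-ones vector, so relabelling commutes with each step from [A^k e] to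
    [A^(k+1) e]. *)
Lemma krylov_perm (n : nat) (s : 'S_n) (A : 'M[rat]_n) :
  krylov (mxsub s s A) = row_perm s (krylov A).
Proof.
have powE k : mxsub s s A ^+ k *m ones n = row_perm s (A ^+ k *m ones n).
  elim: k => [|k IHk].
    by rewrite !expr0 !mul1mx; apply/matrixP=> i j; rewrite !mxE.
  rewrite -(add1n k) !mulmx_expD IHk; apply/matrixP=> i j; rewrite !mxE.
  by rewrite [RHS](reindex_perm s); apply: eq_bigr => l _; rewrite !mxE.
by apply/matrixP=> i k; rewrite mxE powE !mxE.
Qed.

Lemma krylov_classifies (n n' : nat) (A : 'M[rat]_n) (B : 'M[rat]_n') :
    A^T = A -> B^T = B -> (forall i, A i i = 0) -> (forall i, B i i = 0) ->
    (n.-1 <= \rank (krylov A))%N ->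
  (exists s : 'S_n, eqmatrix (mxsub s s A) B) <->
  eqmatrix (lex (krylov A)) (lex (krylov B)).
Proof.
move=> symA symB diagA diagB rankA; split.
  case=> s [[e1 e2]]; case: _ / e1 e2 B symB diagB => e2 B _ _.
  rewrite (eq_axiomK e2) castmx_id => <-; exists (erefl, erefl).
  by rewrite castmx_id; apply/lex_eqP; exists s; rewrite krylov_perm.
case=> -[e1 e2]; case: _ / e1 e2 B symB diagB => e2 B symB diagB.
rewrite (eq_axiomK e2) castmx_id => /lex_eqP[s]; rewrite -krylov_perm => eqK.
exists s, (erefl, erefl); rewrite castmx_id; apply: krylov_inj => //.
- by rewrite trmx_mxsub symA.
- by move=> i; rewrite mxE.
(* Permuting rows is multiplication by an invertible matrix, so the rank bound survives the
   relabelling. *)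
by rewrite krylov_perm row_permE eqmxMfull // row_full_unit unitmx_perm.
Qed.

Lemma adjmx_sym (G : sgraph) : (adjmx G)^T = adjmx G.
Proof. by apply/matrixP=> i j; rewrite !mxE edge_sym. Qed.

Lemma adjmx_diag (G : sgraph) i : adjmx G i i = 0.
Proof. by rewrite mxE edge_irrefl. Qed.

Lemma isomorphic_adjmxP (G H : sgraph) :
  isomorphic G H <->
  exists s : 'S_#|G|, eqmatrix (mxsub s s (adjmx G)) (adjmx H).
Proof.
split=> [[f bijf edgef] | [s [[e e'] eqGH]]].
  have e := bij_eq_card bijf; case: bijf => g fK gK.
  (* [mxsub s s] reads entry [(i, j)] at [(s i, s j)], so [s] must send numbers in [H] to numbers in
     [G], hence the inverse [g] of [f]. *)
  pose h (i : 'I_#|G|) : 'I_#|G| := enum_rank (g (enum_val (cast_ord e i))).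
  have inj_h : injective h.
    move=> i j /enum_rank_inj /(can_inj gK) /enum_val_inj.
    exact: cast_ord_inj.
  exists (perm inj_h), (e, e); apply/matrixP=> i j.
  by rewrite castmxE !mxE !permE !enum_rankK -edgef !gK !cast_ordKV.
rewrite (eq_irrelevance e' e) in eqGH.
pose f (x : G) : H := enum_val (cast_ord e (s^-1%g (enum_rank x))).
exists f.
  exists (fun y => enum_val (s (cast_ord (esym e) (enum_rank y)))) => [x | y].
    by rewrite /f enum_valK cast_ordK permKV enum_rankK.
  by rewrite /f enum_valK permK cast_ordKV enum_rankK.
(* Edges are recovered from matrix entries, since 0 and 1 differ in [rat]. *)
move=> x y; apply: (can_inj oddb); apply/eqP; rewrite -(eqr_nat rat); apply/eqP.
have /matrixP/(_ (enum_rank (f x)) (enum_rank (f y))) := eqGH.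
by rewrite castmxE !mxE /f !enum_valK !cast_ordK !permKV !enum_rankK.
Qed.

Theorem theorem1p3 (G Gstar : sgraph)
    (hrank : (#|G|.-1 <= \rank (walkmx G))%N) :
  isomorphic G Gstar <-> eqmatrix (lex (walkmx G)) (lex (walkmx Gstar)).
Proof.
apply: iff_trans (isomorphic_adjmxP G Gstar) _.
by apply: krylov_classifies; rewrite ?adjmx_sym //; apply: adjmx_diag.
Qed.
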